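(* Euler's constant $\gamma$ is rational if and only if there exists $N$ such that for all integers $n\ge N$ the fractional part of $d_{3^n}L_{n,3^n-3,3}$ equals $d_{3^n}I_{n,3^n-3,3}$.
   Context: $d_M$ denotes the least common multiple of $1,\dots,M$. For real $q>1$ the $q$-logarithm is $\ln_q(1+z)=\sum_{\mu=1}^\infty \frac{(-1)^{\mu-1}z^\mu}{q^\mu-1}$ for $|z|<q$. For integers $n,m\ge0$ let $$I_{n,m,3}=\int_0^1\frac{2+x}{1+x+x^2}(1-x)^m\sum_{\nu=n+1}^\infty x^{3^\nu-1}\,dx.$$ Define polynomials $Q_k(x)$ by $Q_0=0$, $Q_{k+1}(x)=(1-x)^6Q_k(x)+(-3)^{3k}(28-34x+21x^2-7x^3+x^4)$, and integers $a_{j,k}$ by $(2+x)Q_k(x)=\sum_{j=0}^{6k-1}a_{j,k}x^j$. For $m=6k<3^{n+1}$ let $$L_{n,m,3}=(-3)^{3k}n\log3+\sum_{j=1}^{m-1}\frac{a_{j,k}}j\ln_3\Big(1+\frac j{3^n}\Big).$$ (Note $3^n-3$ is a multiple of $6$ for $n\ge1$.) *)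

(* Defs.v *)
From HB Require Import structures.
From mathcomp Require Import all_boot all_order all_algebra.
From mathcomp Require Import all_classical all_reals all_analysis.

Set Implicit Arguments.
Unset Strict Implicit.
Unset Printing Implicit Defensive.

Import Order.TTheory GRing.Theory Num.Theory.
Import numFieldNormedType.Exports.

Local Open Scope ring_scope.

(* [series harmonic n] is the n-th harmonic number 1 + 1/2 + ... + 1/n. *)
Definition euler_gamma (R : realType) : R :=
  limn (fun n => series (@harmonic R) n - ln n%:R).

Definition frac_part (R : realType) (x : R) : R := x - (Num.floor x)%:~R.

Definition lcm_upto (M : nat) : nat := \big[lcmn/1%N]_(1 <= i < M.+1) i.

(* The q-logarithm as a function of its full argument y = 1 + z; the series
   converges for q > 1 and `|y - 1| < q. *)
Definition lnq (R : realType) (q y : R) : R :=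
  limn (fun M =>
    \sum_(1 <= mu < M) (-1) ^+ mu.-1 * (y - 1) ^+ mu / (q ^+ mu - 1)).

(* The integrand is nonnegative; its series is summed in \bar R because it
   diverges at the endpoint x = 1. *)
Definition I3 (R : realType) (n m : nat) : \bar R :=
  (\int[lebesgue_measure]_(x in `[0%R, 1%R])
     (((2 + x) / (1 + x + x ^+ 2) * (1 - x) ^+ m)%:E
      * \sum_(n.+1 <= nu <oo) (x ^+ (3 ^ nu - 1))%:E))%E.

Fixpoint Qpoly (k : nat) : {poly int} :=
  if k is k'.+1 then
    (1 - 'X) ^+ 6 * Qpoly k'
    + ((-3) ^+ (3 * k'))%:P
      * (28%:P - 34%:P * 'X + 21%:P * 'X^2 - 7%:P * 'X^3 + 'X^4)
  else 0.

Definition acoef (j k : nat) : int := ((2%:P + 'X) * Qpoly k)`_j.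

(* Meaningful only when m is a multiple of 6 and m < 3 ^ n.+1. *)
Definition L3 (R : realType) (n m : nat) : R :=
  let k := (m %/ 6)%N in
  (-3) ^+ (3 * k) * n%:R * ln 3
  + \sum_(1 <= j < m) (acoef j k)%:~R / j%:R * lnq 3 (1 + j%:R / 3 ^+ n).

(* Main.v *)
(* Since (1 - x)^6 = -27 modulo 1 + x + x^2, one has
   (1 - x)^(6k) = (-27)^k + (1 + x + x^2) Q_k(x), and integrating term by term
   expresses I_{n,6k,3} through the integrals of
   (2 + x)/(1 + x + x^2) x^(3^nu - 1), which are
   H_(3^nu - 1) - H_(3^(nu-1) - 1) - log 3 and telescope to Euler's constant,
   and the sums over nu > n of 1/(3^nu + j), which are values of the
   3-logarithm. This gives
     I_{n,6k,3} = L_{n,6k,3} + (-27)^k (gamma - H_(3^n)) + 3^(-n),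
   so that d (I - L) is an integer, d = d_(3^n), exactly when (-27)^k d gamma
   is. It remains to see that 0 <= d I < 1 for 6k = 3^n - 3 and n >= 3:
   d_(3N) divides d_N (3N)!/(N!)^3, whence d <= 27^((3^n - 1)/2), while the
   maximum 27/256 of x^3 (1 - x) on [0, 1] bounds I by
   3 (27/256)^(3^n - 3). *)
Require Import Defs.
From mathcomp Require Import all_boot all_order all_algebra.
From mathcomp Require Import all_classical all_reals all_analysis.
From mathcomp Require Import zify ring lra.
Set Implicit Arguments.
Unset Strict Implicit.
Unset Printing Implicit Defensive.
Import Order.TTheory GRing.Theory Num.Theory.
Import numFieldNormedType.Exports.
Local Open Scope classical_set_scope.
Local Open Scope ring_scope.

(** * Least common multiples *)

Lemma dvdn_lcm_upto (i M : nat) : (0 < i <= M)%N -> (i %| lcm_upto M)%N.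
Proof.
move=> /andP[i0 iM]; rewrite /lcm_upto (@big_cat_nat _ _ _ i)//=; last by lia.
by rewrite (@big_ltn _ _ _ i) ?ltnS//
  (dvdn_trans (dvdn_lcml i _) (dvdn_lcmr _ _)).
Qed.

Lemma lcm_upto_dvdn (M d : nat) :
  (forall i, (0 < i <= M)%N -> (i %| d)%N) -> (lcm_upto M %| d)%N.
Proof.
move=> h; rewrite /lcm_upto big_seq_cond.
elim/big_ind : _ => [|x y xd yd|i]; first exact: dvd1n.
- by rewrite dvdn_lcm xd.
- by rewrite mem_index_iota andbT => i1; apply: h; lia.
Qed.

Lemma lcm_upto_gt0 (M : nat) : (0 < lcm_upto M)%N.
Proof.
rewrite /lcm_upto big_seq_cond; elim/big_ind : _ => // [x y x0 y0|i].
  by rewrite lcmn_gt0 x0.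
by rewrite mem_index_iota andbT => /andP[].
Qed.

(* The p-adic valuation of (3n)!/(n!)^3 is the sum over k of
   floor(3n/p^k) - 3 floor(n/p^k) >= 0, which is at least 1 for each k such
   that n < p^k <= 3n. *)
Lemma logn_fact3 (p n a : nat) : prime p -> (p ^ a <= 3 * n)%N ->
  (a + 3 * logn p n`! <= trunc_log p n + logn p (3 * n)`!)%N.
Proof.
move=> pp pa; have p1 := prime_gt1 pp; have p0 := prime_gt0 pp.
rewrite !logn_fact// (@big_cat_nat _ _ _ n.+1 1 (3 * n).+1)//=; last by lia.
have [n0|n0] := posnP n.
  by move: pa; rewrite n0 muln0 leqn0 expn_eq0; lia.
set t := trunc_log p n.
have tn : (p ^ t <= n)%N by exact: trunc_logP.
have nt : (n < p ^ t.+1)%N by exact: trunc_log_ltn.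
rewrite -big_cat_nat//=; last by lia.
have -> : (\sum_(1 <= k < n.+1) n %/ p ^ k =
  \sum_(1 <= k < (3 * n).+1) n %/ p ^ k)%N.
  rewrite [RHS](@big_cat_nat _ _ _ n.+1)//=; last by lia.
  rewrite [X in (_ + X)%N]big_nat_cond [X in (_ + X)%N]big1 ?addn0// => i.
  rewrite andbT => /andP[ni _]; rewrite divn_small//.
  by rewrite (leq_trans ni)// ltnW// ltn_expl.
(* The indicator counts the exponents above [t] and at most [a]; they lie in the range because a <
   p^a <= 3n. *)
have ha : (a <= t + \sum_(1 <= k < (3 * n).+1) (t < k <= a))%N.
  have [at_|ta] := leqP a t; first by lia.
  have a3 : (a <= 3 * n)%N by rewrite (leq_trans _ pa)// ltnW// ltn_expl.
  rewrite (@big_cat_nat _ _ _ t.+1)//=; last by lia.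
  rewrite [X in (_ + (_ + X))%N](@big_cat_nat _ _ _ a.+1)//=; last by lia.
  rewrite [X in (_ + (_ + (X + _)))%N](_ : _ = a - t)%N; first by lia.
  rewrite (eq_big_nat _ _ (F2 := fun=> 1%N)); last first.
    by move=> i; rewrite ltnS => ->.
  by rewrite sum_nat_const_nat muln1 subSS.
rewrite big_distrr/= (leq_trans (leq_add ha (leqnn _)))// -addnA leq_add2l.
rewrite -big_split/= leq_sum// => i _.
have pi0 : (0 < p ^ i)%N by rewrite expn_gt0 p0.
have le3 : (3 * (n %/ p ^ i) <= 3 * n %/ p ^ i)%N.
  by rewrite leq_divRL// -mulnA leq_mul2l leq_trunc_div.
case: (boolP (t < i <= a)%N) => [/andP[ti ia]|//].
have -> : (n %/ p ^ i = 0)%N.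
  by rewrite divn_small// (leq_trans nt)// leq_pexp2l.
rewrite muln0 addn0.
by rewrite divn_gt0// (leq_trans _ pa)// leq_pexp2l.
Qed.

(** Checked prime by prime. If i <= 3n has p-adic valuation a, then p^a <= 3n, so [logn_fact3]
    bounds a by [trunc_log p n], at most the valuation of d_n, plus the valuation of
    (3n)!/(n!)^3. *)
Lemma lcm_upto_mul3 (n : nat) :
  (lcm_upto (3 * n) * n`! ^ 3 %| lcm_upto n * (3 * n)`!)%N.
Proof.
have h3 : (n`! ^ 3 %| (3 * n)`!)%N.
  apply/dvdn_partP => [|p]; first by rewrite expn_gt0 fact_gt0.
  rewrite mem_primes => /and3P[pp _ _].
  rewrite p_part pfactor_dvdn ?fact_gt0// lognX.
  have [n0|n0] := posnP n; first by rewrite n0 muln0 fact0 logn1.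
  (* For this exponent the two logarithms in [logn_fact3] cancel, leaving just the comparison of
     (n!)^3 with (3n)!. *)
  have tn : (p ^ trunc_log p n <= 3 * n)%N.
    by rewrite (leq_trans (trunc_logP (prime_gt1 pp) n0))// leq_pmull.
  have := logn_fact3 pp tn. by lia.
rewrite -(divnK h3) mulnA dvdn_pmul2r ?expn_gt0 ?fact_gt0//.
apply: lcm_upto_dvdn => i /andP[i0 i3n].
apply/dvdn_partP => // p; rewrite mem_primes => /and3P[pp _ _].
have n0 : (0 < n)%N by lia.
have q0 : (0 < (3 * n)`! %/ n`! ^ 3)%N.
  by rewrite divn_gt0 ?expn_gt0 ?fact_gt0// dvdn_leq// fact_gt0.
rewrite p_part pfactor_dvdn ?muln_gt0 ?lcm_upto_gt0// lognM ?lcm_upto_gt0//.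
rewrite logn_div// lognX.
have h1 : (p ^ logn p i <= 3 * n)%N.
  by rewrite (leq_trans _ i3n)// dvdn_leq// pfactor_dvdnn.
have h2 : (trunc_log p n <= logn p (lcm_upto n))%N.
  rewrite -pfactor_dvdn ?lcm_upto_gt0// dvdn_lcm_upto// expn_gt0 prime_gt0//=.
  by rewrite trunc_logP ?prime_gt1.
by have := logn_fact3 pp h1; lia.
Qed.

(** The induction step is (3n+3)(3n+2)(3n+1) <= 27(n+1)^3. *)
Lemma fact3_le (n : nat) : ((3 * n)`! <= 27 ^ n * n`! ^ 3)%N.
Proof.
elim: n => [|n ih]; first by [].
rewrite mulnS !addSn add0n !factS expnS.
have : ((3 * n).+3 * ((3 * n).+2 * (3 * n).+1) <= 27 * n.+1 ^ 3)%N by nia.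
move/leq_mul => /(_ _ _ ih); rewrite expnMn.
by rewrite -!mulnA => /leq_trans; apply; nia.
Qed.

Lemma lcm_upto_le3 (n : nat) : (lcm_upto (3 * n) <= 27 ^ n * lcm_upto n)%N.
Proof.
have f0 : (0 < n`! ^ 3)%N by rewrite expn_gt0 fact_gt0.
rewrite -(leq_pmul2r f0); apply: (@leq_trans (lcm_upto n * (3 * n)`!)).
  by rewrite dvdn_leq ?lcm_upto_mul3// muln_gt0 lcm_upto_gt0 fact_gt0.
by rewrite (mulnC (27 ^ n)%N) -mulnA leq_mul2l fact3_le orbT.
Qed.

(** Iterating [lcm_upto_le3] from d_1 = 1 collects the exponent 1 + 3 + ... + 3^(n-1) = (3^n -
    1)/2. *)
Lemma lcm_upto_pow3_le (n : nat) : (lcm_upto (3 ^ n) <= 27 ^ (3 ^ n)./2)%N.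
Proof.
elim: n => [|n ih]; first by rewrite /lcm_upto big_nat1.
rewrite expnS (leq_trans (lcm_upto_le3 _))//.
rewrite (leq_trans (leq_mul (leqnn _) ih))// -expnD leq_pexp2l//.
by lia.
Qed.

(** * Euler's constant and the 3-logarithm *)

Lemma eq_cvgn (R : realType) (N : nat) (u v : nat -> R) (l : R) :
  v @ \oo --> l -> (forall n, (N <= n)%N -> u n = v n) -> u @ \oo --> l.
Proof.
move=> + uv; apply: cvg_trans; apply: near_eq_cvg; exists N => // n /= /uv.
by [].
Qed.

(** From index 1 on the sequence is nonincreasing and nonnegative. Both facts come from ln(1 + x) <=
    x, at x = -1/(n+2) and x = 1/(n+1). Index 0 is shifted away, since [ln] takes a default value
    there. *)
Lemma cvg_euler_gamma (R : realType) :
  (series (@harmonic R) n - ln n%:R) @[n --> \oo] --> euler_gamma R.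
Proof.
set u := fun n => _ - _.
suff : cvgn (fun n => u n.+1).
  by move=> /cvg_ex[l]; rewrite (@cvg_shiftS _ u) => ul; apply/cvgP: ul.
have lnS (n : nat) : ln n.+2%:R - ln n.+1%:R = ln (1 + n.+1%:R^-1) :> R.
  rewrite -ln_div ?posrE//; congr (ln _).
  by rewrite -(natr1 n.+1) mulrDl mul1r divff.
have lnS' (n : nat) : ln n.+1%:R - ln n.+2%:R = ln (1 + - n.+2%:R^-1) :> R.
  rewrite -ln_div ?posrE//; congr (ln _).
  apply: (@mulIf _ n.+2%:R) => //; rewrite mulrDl mulNr mulVf// divfK// mul1r.
  by rewrite -(natr1 n.+1) addrK.
apply: nonincreasing_is_cvgn.
  apply/nonincreasing_seqP => n; rewrite /u (seriesSr _ n.+1) {2}/harmonic/=.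
  have : ln (1 + - n.+2%:R^-1) <= - n.+2%:R^-1 :> R.
    by apply: le_ln1Dx; rewrite ltrN2 invf_lt1// ltr1n.
  by rewrite -lnS'; move: (ln n.+1%:R) (ln n.+2%:R) n.+2%:R^-1 => a b c; lra.
exists 0 => _ [n _ <-]; rewrite /u subr_ge0.
suff : ln n.+1%:R <= series (@harmonic R) n.
  move=> /le_trans; apply; rewrite seriesSr lerDl; exact: harmonic_ge0.
elim: n => [|n ih]; first by rewrite ln1 /series/= big_nil.
rewrite seriesSr /harmonic/=.
have : ln (1 + n.+1%:R^-1) <= n.+1%:R^-1 :> R.
  by apply: le_ln1Dx; rewrite (@lt_le_trans _ _ 0)// invr_ge0.
by rewrite -lnS; move: (ln n.+1%:R) (ln n.+2%:R) n.+1%:R^-1 ih => a b c; lra.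
Qed.

Lemma cvgn_ge_id (f : nat -> nat) : (forall n, (n <= f n)%N) -> f @ \oo --> \oo.
Proof.
move=> nf; apply/cvgnyPge => A; exists A => // n /= An.
exact: leq_trans An (nf n).
Qed.

(** For n >= 1, H_n - H_(3n) = (H_n - ln n) - (H_(3n) - ln(3n)) - ln 3, and both brackets tend to
    Euler's constant. *)
Lemma cvg_harmonic_sub_mul3 (R : realType) :
  (series (@harmonic R) n - series (@harmonic R) (3 * n)%N) @[n --> \oo]
  --> - ln (3 : R).
Proof.
have cg := @cvg_euler_gamma R.
have c3 : ((muln 3) @ \oo --> \oo)%classic.
  by apply: cvgn_ge_id => n; rewrite leq_pmull.
have := cvg_comp _ _ c3 cg => cg3.
have := cvgB (cvgB cg cg3) (cvg_cst (ln 3 : R)).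
rewrite subrr sub0r => h.
apply: (eq_cvgn (N := 1) (h _ _ _)) => n n0 /=.
rewrite !fctE natrM lnM ?posrE ?ltr0n//.
by move: (ln 3) (ln n%:R) => a b; lra.
Qed.

(** The case j = 0 of the sums over nu > n of 1/(3^nu + j), which the 3-logarithm formula, dividing
    by j, does not cover. *)
Lemma cvg_sum_pow3V (R : realType) (n : nat) :
  (\sum_(0 <= i < V) ((3 : R) ^+ (i + n.+1))^-1) @[V --> \oo]
  --> ((3 : R) ^+ n)^-1 / 2.
Proof.
have -> : (fun V => \sum_(0 <= i < V) (3 ^+ (i + n.+1))^-1) =
    (fun V => (3 ^+ n)^-1 / 2 - (3 ^+ n)^-1 / 2 * (3^-1) ^+ V) :> (nat -> R).
  apply/funext; elim => [|V ih].
    by rewrite big_nil expr0 mulr1 subrr.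
  rewrite big_nat_recr//= ih !exprVn addnS -addSn exprD exprS.
  have h3 : (3 : R) ^+ n != 0 by rewrite expf_neq0.
  have h4 : (3 : R) ^+ V != 0 by rewrite expf_neq0.
  by field; rewrite h3 h4.
rewrite -[X in _ --> X]subr0; apply: cvgB; first exact: cvg_cst.
rewrite -[X in _ --> X](mulr0 ((3 ^+ n)^-1 / 2)); apply: cvgMl_tmp.
by apply: cvg_expr; rewrite ger0_norm// invf_lt1// ltr1n.
Qed.

Definition lnq3_psum (R : realType) (M : nat) (z : R) : R :=
  \sum_(0 <= mu < M) (-1) ^+ mu * z ^+ mu.+1 / (3 ^+ mu.+1 - 1).

Lemma pow3_sub1_gt0 (R : realType) (n : nat) : 0 < 3 ^+ n.+1 - 1 :> R.
Proof. by rewrite subr_gt0 exprn_egt1// ltr1n. Qed.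

(** Truncation of ln_3(1 + z) = ln_3(1 + z/3) + z/(3 + z). As z^mu - (z/3)^mu = (3^mu - 1)(z/3)^mu,
    the denominators cancel and a finite geometric sum of ratio -z/3 remains. *)
Lemma lnq3_psum_div3 (R : realType) (M : nat) (z : R) : 0 <= z ->
  lnq3_psum M z =
  lnq3_psum M (z / 3) + z / (3 + z) * (1 - (- (z / 3)) ^+ M).
Proof.
move=> z0; rewrite /lnq3_psum.
elim: M => [|M ih]; first by rewrite !big_nil expr0 subrr mulr0 addr0.
rewrite !big_nat_recr//= ih -!addrA; congr (_ + _).
have h1 : (3 : R) ^+ M.+1 - 1 != 0 by rewrite gt_eqF// pow3_sub1_gt0.
have h3 : (3 : R) ^+ M != 0 by rewrite expf_neq0.
rewrite exprS in h1.
rewrite !exprS !(exprNn (z / 3)) !expr_div_n.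
by field; rewrite h3 h1 andbT lt0r_neq0//; lra.
Qed.

Lemma lnq3_psum_pow3 (R : realType) (V M : nat) (z : R) : 0 <= z ->
  lnq3_psum M z = lnq3_psum M (z / 3 ^+ V)
  + \sum_(0 <= i < V) z / (3 ^+ i.+1 + z) * (1 - (- (z / 3 ^+ i.+1)) ^+ M).
Proof.
move=> z0; elim: V => [|V ih].
  by rewrite big_nil expr0 divr1 addr0.
have h3 : 0 < (3 : R) ^+ V by rewrite exprn_gt0.
have h : z / 3 ^+ V / 3 = z / 3 ^+ V.+1 by rewrite exprS invfM; ring.
have h' : z / 3 ^+ V / (3 + z / 3 ^+ V) = z / (3 ^+ V.+1 + z).
  have h4 : 3 * 3 ^+ V + z != 0 by rewrite gt_eqF// ltr_wpDr// mulr_gt0.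
  by rewrite exprS; field; rewrite h4 gt_eqF//= lt0r_neq0//.
rewrite big_nat_recr//= ih lnq3_psum_div3 ?h ?h' ?divr_ge0 ?(ltW h3)//.
by rewrite addrAC addrA.
Qed.

(** Take V = M in [lnq3_psum_pow3]. The partial sum at z/3^M and the truncation errors each consist
    of M terms of size at most 3^(-M), and M <= 2^M. *)
Lemma lnq3_psum_approx (R : realType) (M : nat) (z : R) : 0 <= z <= 1 ->
  `|lnq3_psum M z - \sum_(0 <= i < M) z / (3 ^+ i.+1 + z)| <= 2 * (2 / 3) ^+ M.
Proof.
move=> /andP[z0 z1].
have p3 (i : nat) : 0 < (3 : R) ^+ i by rewrite exprn_gt0.
have -> : 2 * (2 / 3) ^+ M = (2 / 3) ^+ M + (2 / 3) ^+ M :> R by lra.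
have M2 : M%:R / 3 ^+ M <= (2 / 3) ^+ M :> R.
  by rewrite expr_div_n ler_pM2r ?invr_gt0// -natrX ler_nat ltnW// ltn_expl.
have sumc : \sum_(0 <= i < M) (3 ^+ M)^-1 = M%:R / 3 ^+ M :> R.
  by rewrite sumr_const_nat subn0 mulr_natl.
rewrite (lnq3_psum_pow3 M)// -addrA -sumrB (le_trans (ler_normD _ _))// lerD//.
  apply: le_trans M2; rewrite /lnq3_psum (le_trans (ler_norm_sum _ _ _))//.
  rewrite -sumc.
  apply: ler_sum => i _.
  have zM0 : 0 <= z / 3 ^+ M by rewrite divr_ge0// ltW.
  have zM : z / 3 ^+ M <= (3 ^+ M)^-1 by rewrite ler_piMl// invr_ge0 ltW.
  have zM1 : z / 3 ^+ M <= 1.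
    by rewrite ler_pdivrMr// mul1r (le_trans z1)// exprn_ege1// ler1n.
  have d0 := pow3_sub1_gt0 R i.
  have d1 : 1 <= (3 : R) ^+ i.+1 - 1.
    by have := @exprn_ege1 R i 3; rewrite ler1n exprS => /(_ isT); lra.
  rewrite normrM normrM normrX normrN1 expr1n mul1r !ger0_norm ?exprn_ge0//.
    rewrite (le_trans _ zM)// ler_pdivrMr// (le_trans (_ : _ <= z / 3 ^+ M))//.
      by rewrite exprS ler_piMr// exprn_ile1.
    by rewrite ler_peMr.
  by rewrite invr_ge0 ltW.
apply: le_trans M2; rewrite (le_trans (ler_norm_sum _ _ _))//.
rewrite -sumc.
apply: ler_sum => i _; rewrite mulrBr mulr1 addrC addKr normrN normrM normrX.
have q0 : 0 <= z / 3 ^+ i.+1 by rewrite divr_ge0// ltW.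
have q1 : 0 <= z / (3 ^+ i.+1 + z) by rewrite divr_ge0// addr_ge0// ltW.
rewrite normrN !ger0_norm// -[X in _ <= X]mul1r ler_pM ?exprn_ge0//.
  by rewrite ler_pdivrMr ?ltr_wpDr// mul1r lerDr ltW.
rewrite -(exprVn 3 M) lerXn2r ?nnegrE ?invr_ge0//.
rewrite ler_pdivrMr// exprS mulrA mulVf// mul1r (le_trans z1)// exprn_ege1//.
by rewrite ler1n.
Qed.

(** Formally, each z/(3^i + z) is expanded in powers of z/3^i and the sums are exchanged.
    [lnq3_psum_approx] replaces the exchange; convergence of the nonnegative series [G] follows from
    a geometric bound. *)
Lemma cvg_lnq3 (R : realType) (z : R) : 0 <= z <= 1 ->
  (\sum_(0 <= i < V) z / (3 ^+ i.+1 + z)) @[V --> \oo] --> lnq 3 (1 + z).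
Proof.
move=> z01; have /andP[z0 z1] := z01.
set G := fun V => _.
have p3 (i : nat) : 0 < (3 : R) ^+ i by rewrite exprn_gt0.
have cG : cvgn G.
  apply: nondecreasing_is_cvgn.
    apply/nondecreasing_seqP => n; rewrite /G big_nat_recr//= lerDl.
    by rewrite divr_ge0// addr_ge0// ltW.
  exists (1 / 2) => _ [n _ <-].
  (* The bound 1/2 is strengthened to a geometric partial sum to make the induction work. *)
  apply: (@le_trans _ _ (1 / 2 - 1 / 2 / 3 ^+ n)); last first.
    by rewrite lerBlDr lerDl divr_ge0// ltW.
  rewrite /G; elim: n => [|n ih]; first by rewrite big_nil expr0 divr1 subrr.
  rewrite big_nat_recr//= (le_trans (lerD ih (_ : _ <= (3 ^+ n.+1)^-1)))//.
    rewrite ler_pdivrMr ?ltr_wpDr// mulrDr mulVf ?gt_eqF//.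
    by rewrite (le_trans z1)// lerDl mulr_ge0// invr_ge0 ltW.
  by rewrite exprS !invfM; move: (_ ^- n) => t; lra.
have SG : (lnq3_psum M z - G M) @[M --> \oo] --> (0 : R).
  apply/norm_cvg0P.
  apply: (@squeeze_cvgr _ _ _ _ (fun=> 0) (fun M => 2 * (2 / 3) ^+ M)).
  - by near=> M; rewrite normr_ge0/= lnq3_psum_approx.
  - exact: cvg_cst.
  - rewrite -[X in _ --> X](mulr0 2); apply: cvgMl_tmp; apply: cvg_expr.
    by rewrite ger0_norm//; lra.
have SlG : (lnq3_psum M z) @[M --> \oo] --> limn G.
  rewrite -[X in _ --> X]add0r.
  by apply: (eq_cvgn (N := 0) (cvgD SG cG)) => M _; rewrite fctE subrK.
suff -> : lnq 3 (1 + z) = limn G by exact: cG.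
(* Partial sums in [lnq] stop before their index, hence the shift by one against [lnq3_psum]. *)
apply/cvg_lim => //; rewrite -cvg_shiftS.
rewrite (_ : (fun n => _) = (fun M => lnq3_psum M z))//; apply/funext => M.
rewrite /lnq3_psum big_add1/=; apply: eq_bigr => i _.
by rewrite addrC addKr.
Unshelve. all: by end_near. Qed.

(** For z = j/3^n, which lies in [0, 1], z/(3^(i+1) + z) = j/(3^(i+n+1) + j). *)
Lemma cvg_sum_pow3DV (R : realType) (n j : nat) : (0 < j <= 3 ^ n)%N ->
  (\sum_(0 <= i < V) ((3 : R) ^+ (i + n.+1) + j%:R)^-1) @[V --> \oo]
  --> j%:R^-1 * lnq (3 : R) (1 + j%:R / 3 ^+ n).
Proof.
move=> /andP[j0 jn].
have p3 (i : nat) : 0 < (3 : R) ^+ i by rewrite exprn_gt0.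
have h : 0 <= (j%:R / 3 ^+ n : R) <= 1.
  by rewrite divr_ge0 ?(ltW (p3 _))//= ler_pdivrMr// mul1r -natrX ler_nat.
apply: (eq_cvgn (N := 0) (v := fun V => j%:R^-1 *
    \sum_(0 <= i < V) j%:R / 3 ^+ n / (3 ^+ i.+1 + j%:R / 3 ^+ n))).
  by apply: cvgMl_tmp; exact: cvg_lnq3.
move=> V _; rewrite big_distrr/=; apply: eq_bigr => i _.
rewrite addnS -addSn exprD.
have h1 : (j%:R : R) != 0 by rewrite pnatr_eq0 -lt0n.
have h2 : (3 : R) ^+ n != 0 by rewrite gt_eqF.
have h3 : 3 ^+ i.+1 * 3 ^+ n + j%:R != 0 :> R.
  by rewrite gt_eqF// ltr_wpDr// mulr_gt0.
by field; rewrite h1 h2 h3.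
Qed.

(** * Integrals over the unit interval *)

Section unit_interval_integrals.
Variable R : realType.
Local Notation mu := (@lebesgue_measure R).
Implicit Types (f : R -> R) (p : {poly R}) (x : R).

Lemma integrable01 f : continuous f -> mu.-integrable `[0, 1] (EFin \o f).
Proof.
move=> cf; apply: continuous_compact_integrable; first exact: segment_compact.
exact: continuous_subspaceT.
Qed.

Lemma Rintegral01_deriv p :
  \int[mu]_(x in `[0, 1]) p^`().[x] = p.[1] - p.[0].
Proof.
rewrite /Rintegral (@continuous_FTC2 _ _ (horner p))//=.
- by apply: continuous_subspaceT => x; exact: continuous_horner.
- split => [x _||]; first exact: derivable_horner.
    exact/cvg_at_right_filter/continuous_horner.
  exact/cvg_at_left_filter/continuous_horner.
- by move=> x _; rewrite -derivE.
Qed.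

Lemma Rintegral01_sum (c : nat -> R) (n N : nat) :
  \int[mu]_(x in `[0, 1]) (\sum_(0 <= j < n) c j * x ^+ (j + N)) =
  \sum_(0 <= j < n) c j / (j + N).+1%:R.
Proof.
pose p := \sum_(0 <= j < n) (c j / (j + N).+1%:R) *: 'X^((j + N).+1).
transitivity (\int[mu]_(x in `[0, 1]) p^`().[x]).
  apply: eq_Rintegral => x _; rewrite /p raddf_sum horner_sum/=.
  apply: eq_bigr => j _; rewrite derivZ derivXn hornerZ hornerMn hornerXn.
  by rewrite mulrnAr -mulrnAl -(mulr_natr (c j / _)) divfK.
rewrite Rintegral01_deriv !horner_sum -sumrB; apply: eq_bigr => j _.
by rewrite !hornerZ !hornerXn expr1n expr0n mulr0 subr0 mulr1.
Qed.

Lemma Rintegral01_exprn (n : nat) :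
  \int[mu]_(x in `[0, 1]) (x ^+ n) = n.+1%:R^-1.
Proof.
have := Rintegral01_sum (fun=> 1) 1 n; rewrite big_nat1 div1r => <-.
by apply: eq_Rintegral => x _; rewrite big_nat1 mul1r.
Qed.

Lemma continuous_exprM f (n : nat) :
  continuous f -> continuous (fun x => f x * x ^+ n).
Proof. by move=> cf x; apply: cvgM; [exact: cf|exact: exprn_continuous]. Qed.

Definition w3 x : R := (2 + x) / (1 + x + x ^+ 2).

Lemma w3_denom_gt0 x : 0 < 1 + x + x ^+ 2.
Proof. by have := sqr_ge0 (x + 1 / 2); nra. Qed.

Lemma continuous_w3 : continuous w3.
Proof.
move=> x; have c2 : (fun y : R => 2 + y) @ x --> 2 + x.
  by apply: cvgD; [exact: cvg_cst|exact: cvg_id].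
apply: cvgM => //; apply: cvgV; first by rewrite gt_eqF// w3_denom_gt0.
apply: cvgD; last exact: exprn_continuous.
by apply: cvgD; [exact: cvg_cst|exact: cvg_id].
Qed.

Lemma w3_ge0 x : 0 <= x -> 0 <= w3 x.
Proof. by move=> x0; rewrite divr_ge0 ?(ltW (w3_denom_gt0 x))// addr_ge0. Qed.

Lemma w3_le2 x : 0 <= x -> w3 x <= 2.
Proof.
by move=> x0; rewrite /w3 ler_pdivrMr ?w3_denom_gt0//; have := sqr_ge0 x; nra.
Qed.

Definition w3_moment (n : nat) : R := \int[mu]_(x in `[0, 1]) (w3 x * x ^+ n).

Let itv01_ge0 x : `[0%R, 1%R]%classic x -> 0 <= x.
Proof. by rewrite /= in_itv/= => /andP[]. Qed.

Lemma w3_moment_ge0 (n : nat) : 0 <= w3_moment n.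
Proof.
apply: Rintegral_ge0 => x /itv01_ge0 x0.
by rewrite mulr_ge0 ?w3_ge0 ?exprn_ge0.
Qed.

Lemma w3_moment_le (n : nat) : w3_moment n <= 2 / n.+1%:R.
Proof.
rewrite -Rintegral01_exprn -RintegralZl//; last first.
  by apply: integrable01; exact: exprn_continuous.
apply: le_Rintegral => //.
- by apply: integrable01; apply: continuous_exprM; exact: continuous_w3.
- apply: (@integrable01 (fun x => 2 * x ^+ n)).
  by apply: (continuous_exprM (f := fun=> 2)); exact: cst_continuous.
by move=> x /itv01_ge0 x0; rewrite ler_wpM2r ?exprn_ge0// w3_le2.
Qed.

(** The factor 1 - x^3 clears the denominator of the weight: what remains is (1 - x)(2 + x) = 2 - x
    - x^2. *)
Lemma w3_momentD3 (n : nat) : w3_moment n - w3_moment (n + 3) =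
  2 / n.+1%:R - n.+2%:R^-1 - n.+3%:R^-1.
Proof.
rewrite -RintegralB//; last 2 first.
- by apply: integrable01; apply: continuous_exprM; exact: continuous_w3.
- by apply: integrable01; apply: continuous_exprM; exact: continuous_w3.
pose c (j : nat) : R := [:: 2; -1; -1]`_j.
transitivity (\int[mu]_(x in `[0, 1]) (\sum_(0 <= j < 3) c j * x ^+ (j + n))).
  apply: eq_Rintegral => x _; rewrite 3?big_nat_recr//= big_nil /c/= /w3 !exprD.
  by field; rewrite gt_eqF// w3_denom_gt0.
rewrite Rintegral01_sum 3?big_nat_recr//= big_nil /c/= add0r.
by rewrite !mulN1r.
Qed.

(** By [w3_momentD3] the difference [D] does not depend on M, so it equals its limit, which is -ln 3
    because the moments tend to 0. The term 2/(3M) = 1/M - 1/(3M) comes from rewriting H_(3M-1) -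
    H_(M-1). *)
Lemma w3_moment_harmonic (M : nat) : (0 < M)%N ->
  w3_moment (3 * M).-1 = series (@harmonic R) (3 * M)%N - series (@harmonic R) M
    + 2 / (3 * M)%:R - ln 3.
Proof.
case: M => // M _.
pose D k := w3_moment (3 * k.+1).-1 - (series (@harmonic R) (3 * k.+1)%N
    - series (@harmonic R) k.+1 + 2 / (3 * k.+1)%:R).
suff : D M = - ln 3 by rewrite /D => <-; ring.
have DE k : D k = D 0%N.
  elim: k => // k <-; rewrite /D.
  have -> : (3 * k.+2 = (3 * k.+1).+3)%N by lia.
  have := w3_momentD3 (3 * k.+1).-1.
  have -> : ((3 * k.+1).-1 + 3 = (3 * k.+1).+2)%N by lia.
  have -> : ((3 * k.+1).-1.+1 = 3 * k.+1)%N by lia.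
  move=> /eqP; rewrite subr_eq => /eqP ->.
  rewrite !(seriesSr _ (3 * k.+1).+2) (seriesSr _ (3 * k.+1).+1).
  rewrite (seriesSr _ (3 * k.+1)) (seriesSr _ k.+1) /harmonic/=.
  have -> : ((3 * k.+1).+3 = 3 * k.+2)%N by lia.
  rewrite natrM invfM; move: (w3_moment _) => a.
  move: (series _ (3 * k.+1)%N) (series _ k.+1) (3 * k.+1)%:R^-1 => s3 s1 v.
  by move: (3 * k.+1).+1%:R^-1 (3 * k.+1).+2%:R^-1 k.+2%:R^-1 => i1 i2 u; lra.
rewrite DE; have cD : D @ \oo --> D 0%N.
  by rewrite (_ : D = fun=> D 0%N); [exact: cvg_cst|exact/funext].
apply: (cvg_unique _ cD) => //.
have c0 : (fun k => 2 / (3 * k.+1)%:R) @ \oo --> (0 : R).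
  rewrite -(mulr0 (2 : R)); apply: cvgMl_tmp.
  apply: (squeeze_cvgr _ (cvg_cst 0) (@cvg_harmonic R)).
  near=> k; rewrite invr_ge0 ler0n/= /harmonic/= lef_pV2 ?posrE// ler_nat.
  by rewrite leq_pmull.
have c1 : (fun k => w3_moment (3 * k.+1).-1) @ \oo --> (0 : R).
  apply: (squeeze_cvgr _ (cvg_cst 0) c0).
  near=> k; rewrite w3_moment_ge0/=.
  by rewrite -[X in _ <= 2 / X%:R](@prednK (3 * k.+1)) ?w3_moment_le.
have c2 : (fun k => series (@harmonic R) k.+1 -
    series (@harmonic R) (3 * k.+1)%N) @ \oo --> - ln (3 : R).
  pose g n : R := series (@harmonic R) n - series (@harmonic R) (3 * n)%N.
  have : g @ \oo --> - ln (3 : R) by exact: cvg_harmonic_sub_mul3.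
  by rewrite -cvg_shiftS.
apply: (eq_cvgn (N := 0) (v := fun k => w3_moment (3 * k.+1).-1 +
    (series (@harmonic R) k.+1 - series (@harmonic R) (3 * k.+1)%N)
    - 2 / (3 * k.+1)%:R)).
  rewrite -[X in _ --> X]subr0 -[X in _ --> X - _]add0r.
  by apply: cvgB => //; apply: cvgD.
by move=> k _; rewrite /D; ring.
Unshelve. all: by end_near. Qed.

End unit_interval_integrals.

(** * The closed form of the integral *)

(** The quartic in the recursion is the cofactor in (1 - x)^6 + 27 = (1 + x + x^2)(28 - 34x + 21x^2
    - 7x^3 + x^4). *)
Lemma Qpoly_factor (k : nat) :
  (1 - 'X) ^+ (6 * k) - ((-3) ^+ (3 * k))%:P =
  (1 + 'X + 'X^2) * Qpoly k :> {poly int}.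
Proof.
elim: k => [|k ih]; first by rewrite /= mulr0 !expr0 subrr.
have -> : Qpoly k.+1 = (1 - 'X) ^+ 6 * Qpoly k + ((-3) ^+ (3 * k))%:P *
  (28%:P - 34%:P * 'X + 21%:P * 'X^2 - 7%:P * 'X^3 + 'X^4) by [].
rewrite mulrDr mulrCA -ih (mulnS 6) (mulnS 3) (exprD _ 6) (exprD _ 3) polyCM.
have PE (n : nat) : (n%:R)%:P = n%:R :> {poly int} by rewrite rmorph_nat.
have -> : ((-3) ^+ 3)%:P = - 27%:R :> {poly int} by rewrite -PE -polyCN.
by rewrite !PE; ring.
Qed.

(** Ensures that the indices j < 6k exhaust the coefficients of (2 + x) Q_k. *)
Lemma size_Qpoly (k : nat) : (size (Qpoly k) <= (6 * k).-1)%N.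
Proof.
elim: k => [|k ih]; first by rewrite size_poly0.
have -> : Qpoly k.+1 = (1 - 'X) ^+ 6 * Qpoly k + ((-3) ^+ (3 * k))%:P *
  (28%:P - 34%:P * 'X + 21%:P * 'X^2 - 7%:P * 'X^3 + 'X^4) by [].
apply: leq_trans (size_polyD _ _) _; rewrite geq_max; apply/andP; split.
  case: k ih => [|k] ih; first by rewrite mulr0 size_poly0.
  apply: leq_trans (size_polyMleq _ _) _.
  have : (size ((1 - 'X : {poly int}) ^+ 6) <= 7)%N.
    apply: leq_trans (size_poly_exp_leq _ _) _.
    by rewrite -opprB size_polyN size_XsubC.
  by move: ih; move: (size _) (size (Qpoly _)) => a b; lia.
rewrite mul_polyC; apply: leq_trans (size_scale_leq _ _) _.
have -> : 28%:P - 34%:P * 'X + 21%:P * 'X^2 - 7%:P * 'X^3 + 'X^4 =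
  Poly [:: 28; -34; 21; -7; 1] :> {poly int}.
  rewrite /= !cons_poly_def.
  rewrite !polyCN.
  have PE (n : nat) : (n%:R)%:P = n%:R :> {poly int} by rewrite rmorph_nat.
  by rewrite !PE; ring.
by apply: leq_trans (size_Poly _) _; rewrite mulnS.
Qed.

(** Obtained from [Qpoly_factor] at x = 0. The sum in [L3] starts at j = 1, so this coefficient is
    accounted for separately. *)
Lemma acoef0 (k : nat) : acoef 0 k = 2 * (1 - (-3) ^+ (3 * k)).
Proof.
rewrite /acoef coefM big_ord1 coefD coefC coefX/= addr0; congr (_ * _).
have := congr1 (fun p : {poly int} => p`_0) (Qpoly_factor k).
rewrite coefM big_ord1 !coefD coef1 coefX coefXn/= !addr0 mul1r => <-.
by rewrite coefN coefC/= -!horner_coef0 horner_exp !hornerE expr1n.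
Qed.

Lemma expr_sub1_Qpoly (R : realType) (k : nat) (x : R) :
  (1 - x) ^+ (6 * k) = (-3) ^+ (3 * k) + (1 + x + x ^+ 2) *
    (map_poly intr (Qpoly k)).[x].
Proof.
have := congr1 (fun p => (map_poly (intr : int -> R) p).[x]) (Qpoly_factor k).
rewrite !(rmorphM, rmorphB, rmorphD, rmorphXn, rmorph1)/= !map_polyX.
rewrite map_polyC/= !hornerE rmorphN/= => /eqP.
by rewrite subr_eq => /eqP ->; rewrite addrC expr2.
Qed.

Lemma sum_acoef (R : realType) (k : nat) (x : R) :
  (2 + x) * (map_poly intr (Qpoly k)).[x] =
  \sum_(0 <= j < 6 * k) (acoef j k)%:~R * x ^+ j.
Proof.
have -> : (2 + x) * (map_poly intr (Qpoly k)).[x] =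
    (map_poly intr ((2%:P + 'X) * Qpoly k)).[x].
  by rewrite rmorphM rmorphD/= map_polyX map_polyC/= hornerM !hornerE.
rewrite (@horner_coef_wide _ (6 * k)).
  by rewrite big_mkord; apply: eq_bigr => j _; rewrite coef_map.
rewrite size_map_inj_poly//; last exact: intr_inj.
have : (size (2%:P + 'X : {poly int})%R <= 2)%N.
  by rewrite addrC size_XaddC.
have := size_Qpoly k; case: k => [|k]; first by rewrite mulr0 size_poly0.
move=> sQ s2; apply: leq_trans (size_polyMleq _ _) _.
by move: sQ s2; move: (size _) (size (Qpoly _)) => a b; lia.
Qed.

(** * Termwise integration of the kernel series *)

Section kernel_series.
Variables (R : realType) (n k : nat).
Local Notation mu := (@lebesgue_measure R).

Definition I3_term (i : nat) : R := \int[mu]_(x in `[0, 1])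
  (w3 x * (1 - x) ^+ (6 * k) * x ^+ (3 ^ (i + n.+1) - 1)).

Lemma continuous_I3_term (N : nat) :
  continuous (fun x : R => w3 x * (1 - x) ^+ (6 * k) * x ^+ N).
Proof.
apply: continuous_exprM => x; apply: cvgM; first exact: continuous_w3.
by apply: continuous_onemXn.
Qed.

(** In the decomposition of (1 - x)^(6k) the factor 1 + x + x^2 cancels the denominator of [w3], so
    that (2 + x) Q_k is integrated monomial by monomial. *)
Lemma I3_termE (i : nat) : I3_term i =
  (-3) ^+ (3 * k) * w3_moment R (3 ^ (i + n.+1)).-1 +
  \sum_(0 <= j < 6 * k) (acoef j k)%:~R / (3 ^ (i + n.+1) + j)%:R.
Proof.
set N := (3 ^ (i + n.+1))%N; have N0 : (0 < N)%N by rewrite expn_gt0.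
rewrite /w3_moment -RintegralZl//; last first.
  by apply: integrable01; apply: continuous_exprM; exact: continuous_w3.
have -> : \sum_(0 <= j < 6 * k) (acoef j k)%:~R / (N + j)%:R =
    \sum_(0 <= j < 6 * k) (acoef j k)%:~R / (j + N.-1).+1%:R :> R.
  by apply: eq_bigr => j _; rewrite -addnS prednK// addnC.
rewrite -(Rintegral01_sum (fun j => (acoef j k)%:~R)).
rewrite -RintegralD//; last 2 first.
- apply: (@integrable01 _ (fun x => (-3) ^+ (3 * k) * (w3 x * x ^+ N.-1))).
  move=> x; apply: cvgMl_tmp.
  by apply: (continuous_exprM (f := @w3 R)); exact: continuous_w3.
- apply: (@integrable01 _ (fun x => \sum_(0 <= j < 6 * k) _)).
  rewrite (_ : (fun x => _) = horner (\sum_(0 <= j < 6 * k)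
    (acoef j k)%:~R *: 'X^(j + N.-1))); first exact: continuous_horner.
  apply/funext => x; rewrite horner_sum; apply: eq_bigr => j _.
  by rewrite hornerZ hornerXn.
apply: eq_Rintegral => x _.
transitivity ((-3) ^+ (3 * k) * (w3 x * x ^+ N.-1) +
  (2 + x) * (map_poly intr (Qpoly k)).[x] * x ^+ N.-1).
  rewrite expr_sub1_Qpoly subn1 /w3; have := w3_denom_gt0 x => d0.
  by field; rewrite gt_eqF.
rewrite sum_acoef big_distrl/=; congr (_ + _); apply: eq_bigr => j _.
by rewrite exprD mulrA.
Qed.

Lemma I3_integrand_ge0 (N : nat) (x : R) : 0 <= x -> x <= 1 ->
  0 <= w3 x * (1 - x) ^+ (6 * k) * x ^+ N.
Proof.
move=> x0 x1; rewrite mulr_ge0 ?exprn_ge0//.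
by apply: mulr_ge0; [exact: w3_ge0|rewrite exprn_ge0// subr_ge0].
Qed.

Lemma I3_term_ge0 (i : nat) : 0 <= I3_term i.
Proof.
apply: Rintegral_ge0 => x; rewrite /= in_itv/= => /andP[x0 x1].
exact: I3_integrand_ge0.
Qed.

(** All terms are nonnegative on [0, 1], so sum and integral commute in the extended reals; here nu
    = i + n + 1. *)
Lemma I3_eq_lim (l : R) :
  (\sum_(0 <= i < V) I3_term i) @[V --> \oo] --> l -> I3 R n (6 * k) = l%:E.
Proof.
move=> cl; rewrite /I3.
transitivity (\int[mu]_(x in `[0%R, 1%R]) (\sum_(i <oo)
    (w3 x * (1 - x) ^+ (6 * k) * x ^+ (3 ^ (i + n.+1) - 1))%:E))%E.
  apply: eq_integral => x; rewrite inE/= in_itv/= => /andP[x0 x1].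
  rewrite -nneseriesZl; last by move=> i _; rewrite lee_fin exprn_ge0.
  rewrite -(nneseries_addn (f := fun nu => (_ * (x ^+ (3 ^ nu - 1))%:E)%E)).
    by apply: eq_eseriesr => i _; rewrite -EFinM.
  by move=> i; rewrite -EFinM lee_fin; exact: I3_integrand_ge0.
rewrite integral_nneseries//; last 2 first.
- move=> i; apply: (measurable_int mu).
  exact/integrable01/continuous_I3_term.
- move=> i x; rewrite /= in_itv/= => /andP[x0 x1].
  by rewrite lee_fin; exact: I3_integrand_ge0.
rewrite (eq_eseriesr (g := fun i => (I3_term i)%:E)); last first.
  move=> i _; rewrite fineK//; apply: integrable_fin_num => //.
  exact/integrable01/continuous_I3_term.
apply/cvg_lim => //; rewrite (_ : (fun _ => _) =
  EFin \o (fun V => \sum_(0 <= i < V) I3_term i)).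
  by apply: cvg_EFin; [exact: nearW|exact: cl].
by apply/funext => V; rewrite /= sumEFin.
Qed.

End kernel_series.

(** * Summation to Euler's constant and 3-logarithms *)

Section I3_closed_form.
Variables (R : realType) (n k : nat).

Lemma cvg_sum_w3_moment :
  (\sum_(0 <= i < V) w3_moment R (3 ^ (i + n.+1)).-1) @[V --> \oo] -->
  euler_gamma R - series (@harmonic R) (3 ^ n)%N + (3 ^+ n)^-1 + n%:R * ln 3.
Proof.
(* The moment of index 3^v - 1 is u(v) - u(v-1), because 2/3^v = 1/3^(v-1) - 1/3^v; and u tends to
   Euler's constant, because v ln 3 = ln(3^v). *)
pose u v : R := series (@harmonic R) (3 ^ v)%N - (3 ^+ v)^-1 - v%:R * ln 3.
have uE V :
    \sum_(0 <= i < V) w3_moment R (3 ^ (i + n.+1)).-1 = u (V + n)%N - u n.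
  elim: V => [|V ih]; first by rewrite big_nil subrr.
  rewrite big_nat_recr//= ih addnS addSn expnS w3_moment_harmonic ?expn_gt0//.
  rewrite /u expnS natrM natrX exprS invfM -(natr1 (V + n)).
  by move: (ln 3) (_ ^- (V + n)) => t v; lra.
have p3 : ((fun v => 3 ^ v)%N @ \oo --> \oo)%classic.
  by apply: cvgn_ge_id => v; rewrite ltnW// ltn_expl.
have cu : u @ \oo --> euler_gamma R.
  apply: (eq_cvgn (N := 0) (v := fun v => (series (@harmonic R) (3 ^ v)%N
      - ln (3 ^ v)%:R) - (3^-1) ^+ v)).
    rewrite -[X in _ --> X]subr0; apply: cvgB.
      exact: (cvg_comp _ _ p3 (@cvg_euler_gamma R)).
    by apply: cvg_expr; rewrite ger0_norm// invf_lt1// ltr1n.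
  by move=> v _; rewrite /u natrX lnXn// mulr_natl exprVn; ring.
have := cvgB cu (cvg_cst (u n)) => /(_ _ _).
rewrite -(cvg_shiftn n) => h; apply: (eq_cvgn (N := 0)) => [|V _].
  move: h.
  rewrite (_ : _ - u n = euler_gamma R - series (@harmonic R) (3 ^ n)%N +
    (3 ^+ n)^-1 + n%:R * ln 3); last by rewrite /u; ring.
  exact.
by rewrite uE.
Qed.

Lemma cvg_sum_nat (a l : nat -> R) (s : nat -> nat -> R) (m : nat) :
  (forall j, (j < m)%N -> s j @ \oo --> l j) ->
  (\sum_(0 <= j < m) a j * s j V) @[V --> \oo] --> \sum_(0 <= j < m) a j * l j.
Proof.
elim: m => [|m ih] h.
  rewrite big_nil (_ : (fun _ => _) = fun=> 0); first exact: cvg_cst.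
  by apply/funext => V; rewrite big_nil.
rewrite big_nat_recr//=.
apply: (eq_cvgn (N := 0)
  (v := fun V => \sum_(0 <= j < m) a j * s j V + a m * s m V)).
  apply: cvgD; first by apply: ih => j jm; apply: h; rewrite ltnW.
  by apply: cvgMl_tmp; exact: h.
by move=> V _; rewrite big_nat_recr.
Qed.

Hypothesis k_gt0 : (0 < k)%N.
Hypothesis k_le : (6 * k <= 3 ^ n)%N.

Let l : R := (-3) ^+ (3 * k) * (euler_gamma R - series (@harmonic R) (3 ^ n)%N)
  + (3 ^+ n)^-1 + L3 R n (6 * k).

Lemma cvg_sum_I3_term : (\sum_(0 <= i < V) I3_term R n k i) @[V --> \oo] --> l.
Proof.
pose s j V : R := \sum_(0 <= i < V) (3 ^+ (i + n.+1) + j%:R)^-1.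
pose e j : R := if j is 0 then (3 ^+ n)^-1 / 2
  else j%:R^-1 * lnq 3 (1 + j%:R / 3 ^+ n).
have se j : (j < 6 * k)%N -> s j @ \oo --> e j.
  case: j => [_|j jk].
    by apply: (eq_cvgn (N := 0) (@cvg_sum_pow3V R n)) => V _; rewrite /s;
      apply: eq_bigr => i _; rewrite addr0.
  by apply: cvg_sum_pow3DV; rewrite /= (leq_trans _ k_le)// ltnW.
apply: (eq_cvgn (N := 0) (v := fun V =>
    (-3) ^+ (3 * k) * \sum_(0 <= i < V) w3_moment R (3 ^ (i + n.+1)).-1 +
    \sum_(0 <= j < 6 * k) (acoef j k)%:~R * s j V)); last first.
  move=> V _; under eq_bigr do rewrite I3_termE.
  rewrite big_split/= -big_distrr/=; congr (_ + _).
  rewrite exchange_big/=; apply: eq_bigr => j _.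
  by rewrite big_distrr/=; apply: eq_bigr => i _; rewrite natrD natrX.
have -> : l = (-3) ^+ (3 * k) * (euler_gamma R - series (@harmonic R) (3 ^ n)%N
    + (3 ^+ n)^-1 + n%:R * ln 3) + \sum_(0 <= j < 6 * k) (acoef j k)%:~R * e j.
  (* With c = (-27)^k, the term j = 0 gives (1 - c)/3^n; added to c/3^n from the moments it leaves
     the 1/3^n of [l]. *)
  rewrite big_ltn ?muln_gt0// acoef0 /l /L3 mulKn//.
  rewrite rmorphM rmorphB rmorphXn rmorphN rmorph1/=.
  have -> : \sum_(1 <= j < 6 * k) (acoef j k)%:~R * e j =
    \sum_(1 <= j < 6 * k) (acoef j k)%:~R / j%:R * lnq 3 (1 + j%:R / 3 ^+ n).
    by apply: eq_big_nat => -[//|j] _; rewrite /e mulrA.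
  by field; rewrite expf_neq0.
apply: cvgD; last exact: cvg_sum_nat.
by apply: cvgMl_tmp; exact: cvg_sum_w3_moment.
Qed.

Lemma I3E : I3 R n (6 * k) = l%:E.
Proof. by apply: I3_eq_lim; exact: cvg_sum_I3_term. Qed.

End I3_closed_form.

(** * Size and rationality *)

Section I3_bound.
Variable R : realType.

(* On [0, 1] the function x^3 (1 - x) is maximal at x = 3/4. *)
Lemma expr3_onem_le (x : R) : 0 <= x -> (1 - x) * x ^+ 3 <= 27 / 256.
Proof.
move=> x0; rewrite -subr_ge0.
have -> : 27 / 256 - (1 - x) * x ^+ 3 =
  (x - 3 / 4) ^+ 2 * (x ^+ 2 + x / 2 + 3 / 16) by field.
by rewrite mulr_ge0 ?sqr_ge0// !addr_ge0 ?sqr_ge0// divr_ge0.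
Qed.

Variables (n k : nat).
Hypothesis knE : (6 * k + 3 = 3 ^ n)%N.

(** The factor (x^3)^(6k) is split off the power of x and paired with (1 - x)^(6k). The weight is at
    most 2, and the remaining x^N integrates to 1/(N+1) <= 3^(-i). *)
Lemma I3_term_le (i : nat) :
  I3_term R n k i <= 2 * (27 / 256) ^+ (6 * k) * (3^-1) ^+ i.
Proof.
have p0 : (0 < 3 ^ i)%N by rewrite expn_gt0.
have NE : (3 ^ (i + n.+1) - 1 =
    (3 ^ (i + n.+1) - 18 * k).-1 + 3 * (6 * k) /\
    3 ^ i <= (3 ^ (i + n.+1) - 18 * k).-1.+1)%N.
  by rewrite expnD expnS -knE; nia.
rewrite /I3_term; case: NE => ->; set N := (_.-1) => leN.
apply: (@le_trans _ _ (2 * (27 / 256) ^+ (6 * k) * N.+1%:R^-1)); last first.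
  rewrite ler_wpM2l ?mulr_ge0 ?exprn_ge0// exprVn lef_pV2 ?posrE ?exprn_gt0//.
  by rewrite -natrX ler_nat.
rewrite -(Rintegral01_exprn R N) -RintegralZl//; last first.
  by apply: integrable01; exact: exprn_continuous.
apply: le_Rintegral => //.
- exact/integrable01/continuous_I3_term.
- apply: (@integrable01 _ (fun x => _ * x ^+ N)).
  by apply: (continuous_exprM (f := fun=> _)); exact: cst_continuous.
move=> x; rewrite /= in_itv/= => /andP[x0 x1].
rewrite (addnC N) exprD mulrA ler_wpM2r ?exprn_ge0// -mulrA.
apply: ler_pM; [exact: w3_ge0| |exact: w3_le2|].
  by rewrite mulr_ge0 ?exprn_ge0// subr_ge0.
rewrite (exprM x) -exprMn lerXn2r ?nnegrE ?expr3_onem_le//.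
by rewrite mulr_ge0 ?exprn_ge0// subr_ge0.
Qed.

Lemma I3_sum_le (V : nat) :
  \sum_(0 <= i < V) I3_term R n k i <= 3 * (27 / 256) ^+ (6 * k).
Proof.
apply: (@le_trans _ _ (\sum_(0 <= i < V)
    2 * (27 / 256) ^+ (6 * k) * (3^-1) ^+ i)).
  by apply: ler_sum => i _; exact: I3_term_le.
have c0 : 0 <= (27 / 256) ^+ (6 * k) :> R by rewrite exprn_ge0.
apply: (@le_trans _ _ (3 * (27 / 256) ^+ (6 * k) * (1 - (3^-1) ^+ V))).
  elim: V => [|V ih]; first by rewrite big_nil expr0 subrr mulr0.
  rewrite big_nat_recr//= (le_trans (lerD ih (lexx _)))// exprS.
  by move: (_ ^+ (6 * k)) (_ ^+ V) => c v; lra.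
have v0 : 0 <= 3^-1 ^+ V :> R by rewrite exprn_ge0.
by rewrite ler_piMr ?mulr_ge0// lerBlDr lerDl.
Qed.

Lemma lcm_upto_I3_lt1 (l : R) : (3 <= n)%N ->
  (\sum_(0 <= i < V) I3_term R n k i) @[V --> \oo] --> l ->
  0 <= (lcm_upto (3 ^ n))%:R * l < 1.
Proof.
move=> n3 cl.
have l0 : 0 <= l.
  apply: (cvgr_to_ge cl); apply: nearW => V.
  by apply: sumr_ge0 => i _; exact: I3_term_ge0.
have ll : l <= 3 * (27 / 256) ^+ (6 * k).
  by apply: (cvgr_to_le cl); apply: nearW => V; exact: I3_sum_le.
have dle := lcm_upto_pow3_le n.
have n27 : (3 ^ 3 <= 3 ^ n)%N by rewrite leq_pexp2l.
have [g g5 kg] : exists2 g, (5 <= g)%N & (6 * k = 2 * g)%N.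
  by exists (3 * k)%N; lia.
have hE : (3 ^ n)./2 = g.+1 by lia.
rewrite mulr_ge0//=.
have dl : (lcm_upto (3 ^ n))%:R <= 27 ^+ g.+1 :> R.
  by rewrite -natrX ler_nat -hE.
apply: (le_lt_trans (ler_pM _ l0 dl ll)) => //.
(* The product is at most 81 (27^3/256^2)^g. Since 27^3/256^2 < 1/3 and g >= 5, this is at most
   81/3^5 = 1/3. *)
rewrite kg exprM (exprS _ g) mulrACA -exprMn.
have -> : g = (g - 5 + 5)%N by rewrite subnK.
rewrite exprD (@le_lt_trans _ _ (27 * 3 * (1 * (3^-1) ^+ 5)))//; last by lra.
by rewrite ler_pM2l// ler_pM ?exprn_ge0 ?exprn_ile1//; lra.
Qed.

End I3_bound.

(** * Integrality and rationality criteria *)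

Section rationality.
Variable R : realType.

Lemma lcm_upto_divr_int (M i : nat) : (0 < i <= M)%N ->
  ((lcm_upto M)%:R / i%:R : R) \is a Num.int.
Proof.
move=> iM; have /dvdnP[q ->] := dvdn_lcm_upto iM.
by rewrite natrM mulfK ?natr_int// pnatr_eq0; lia.
Qed.

Lemma lcm_upto_harmonic_int (M : nat) :
  ((lcm_upto M)%:R * series (@harmonic R) M) \is a Num.int.
Proof.
rewrite /series/= big_distrr/= big_seq rpred_sum// => i.
by rewrite mem_index_iota => /andP[_ iM]; exact: lcm_upto_divr_int.
Qed.

Lemma frac_part_intB (x y : R) : (x - y) \is a Num.int -> 0 <= x < 1 ->
  frac_part y = x.
Proof.
move=> /intrP[z xyz] /andP[x0 x1]; rewrite /frac_part.
have -> : Num.floor y = - z.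
  by apply: floor_def; rewrite rmorphD rmorphN/= -xyz; lra.
by rewrite rmorphN/= -xyz; lra.
Qed.

Lemma frac_part_eq_intB (x y : R) : frac_part y = x -> (x - y) \is a Num.int.
Proof.
move=> <-; rewrite /frac_part addrAC subrr add0r rpredN.
exact: intr_int.
Qed.

Lemma rational_mul_int (x : R) (d : int) : d != 0 ->
  (d%:~R * x) \is a Num.int -> rational x.
Proof.
move=> d0 /intrP[z zE]; exists (z%:~R / d%:~R) => //.
by rewrite fmorph_div/= !ratr_int -zE mulrC mulKf// intr_eq0.
Qed.

(** A positive denominator b divides d_M as soon as b <= M. *)
Lemma rational_lcm_upto (x : R) : rational x ->
  exists N, forall M, (N <= M)%N -> ((lcm_upto M)%:R * x) \is a Num.int.
Proof.
move=> /rationalP[a [b ->]]; exists b => M bM.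
rewrite mulrCA rpredM ?intr_int//.
have [->|b0] := posnP b; first by rewrite invr0 mulr0 rpred0.
by rewrite lcm_upto_divr_int// b0.
Qed.

End rationality.

Lemma pow3_sub3 (n : nat) : (2 <= n)%N ->
  exists2 k, (0 < k)%N & (6 * k + 3 = 3 ^ n)%N.
Proof.
case: n => [|[|n]]// _; elim: n => [|n [k k0 kE]]; first by exists 1%N.
by exists (3 * k + 1)%N; [lia|rewrite expnS -kE; lia].
Qed.

(* The difference is (-27)^k d gamma minus the integer
   (-27)^k d H_(3^n) - d / 3^n, where d = d_(3^n). *)
Lemma lcm_upto_I3_sub_L3 (R : realType) (n : nat) : (2 <= n)%N ->
  exists l : R, exists k : nat,
  [/\ I3 R n (3 ^ n - 3) = l%:E,
      (3 <= n)%N -> 0 <= (lcm_upto (3 ^ n))%:R * l < 1 &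
      ((lcm_upto (3 ^ n))%:R * l - (lcm_upto (3 ^ n))%:R * L3 R n (3 ^ n - 3)
        \is a Num.int) =
      ((-3) ^+ (3 * k) * ((lcm_upto (3 ^ n))%:R * euler_gamma R)
        \is a Num.int)].
Proof.
move=> n2; have [k k0 kE] := pow3_sub3 n2.
have k_le : (6 * k <= 3 ^ n)%N by lia.
have -> : (3 ^ n - 3 = 6 * k)%N by lia.
exists ((-3) ^+ (3 * k) * (euler_gamma R - series (@harmonic R) (3 ^ n)%N)
  + (3 ^+ n)^-1 + L3 R n (6 * k)), k; split.
- exact: I3E.
- by move=> n3; apply: (lcm_upto_I3_lt1 kE n3); exact: cvg_sum_I3_term.
set d := (lcm_upto _)%:R; set c := (-3) ^+ _; set H := series _ _.
have dH : d * H \is a Num.int by exact: lcm_upto_harmonic_int.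
have d3 : d * (3 ^+ n)^-1 \is a Num.int.
  by rewrite -natrX lcm_upto_divr_int// expn_gt0 leqnn.
have ci : c \is a Num.int by rewrite rpredX// rpredN natr_int.
rewrite [X in X \is a Num.int](_ : _ =
  c * (d * euler_gamma R) + (d * (3 ^+ n)^-1 - c * (d * H))); last by ring.
by rewrite rpredDr// rpredB// rpredM.
Qed.

Unset Implicit Arguments.

Theorem theorem7 (R : realType) :
  rational (euler_gamma R) <->
  exists N : nat, (1 <= N)%N /\
    forall n : nat, (N <= n)%N ->
      (frac_part ((lcm_upto (3 ^ n))%:R * L3 R n (3 ^ n - 3)))%:E
      = (((lcm_upto (3 ^ n))%:R)%:E * I3 R n (3 ^ n - 3))%E.
Proof.
split=> [/rational_lcm_upto[N dN]|[N [_ fN]]].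
  (* N <= n < 3^n makes d times Euler's constant an integer; n >= 3 puts d I in [0, 1). *)
  exists (maxn N 3); split; first by rewrite leq_max orbT.
  move=> n; rewrite geq_max => /andP[Nn n3].
  have [l [k [-> /(_ n3) l01 dlE]]] := lcm_upto_I3_sub_L3 R (ltnW n3).
  rewrite -EFinM; congr (_%:E); apply: frac_part_intB => //.
  rewrite dlE rpredM ?dN//; last first.
    by rewrite (leq_trans Nn)// ltnW// ltn_expl.
  by rewrite rpredX// rpredN natr_int.
(* A single index suffices for the converse: there (-27)^k d is a nonzero integer whose product with
   Euler's constant is an integer. *)
have Nn : (N <= maxn N 2)%N by rewrite leq_max leqnn.
have [|l [k [lE _ dlE]]] := @lcm_upto_I3_sub_L3 R (maxn N 2).
  by rewrite leq_max orbT.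
have := fN _ Nn; rewrite lE -EFinM => -[] /frac_part_eq_intB.
rewrite dlE mulrA => di.
apply: (@rational_mul_int _ _ ((-3) ^+ (3 * k) * (lcm_upto (3 ^ maxn N 2))%:Z)).
  by rewrite mulf_neq0 ?expf_neq0// -lt0n lcm_upto_gt0.
by rewrite rmorphM rmorphXn rmorphN/=.
Qed.
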